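(* Let $x^0,x^1,x^2,\dots$ be the sequence generated by the RPCD algorithm (described in the context) for minimizing $F=f+\phi-h$, with stepsizes $\gamma_1,\dots,\gamma_m>0$. 1. If $\gamma_i\ge L_i$ for $1\le i\le m$, then the sequence $\{x^k\}$ is bounded, $\lim_{k\to\infty}\|x^k-x^{k+1}\|=0$, and every limit point of $\{x^k\}$ is a critical point of $F$. 2. If $\phi(x)=0$, $\gamma_i=L_i$ for $1\le i\le m$, and $\nabla f$ is Lipschitz continuous with constant $L$, then for every $K\ge0$ $$\min_{0\le k\le K}\|\nabla f(x^{k})-v^{k}\|^{2}\le4\left(L_{\max}+\frac{mL^{2}}{L_{\min}}\right)\frac{F(x^{0})-F(x^{*})}{K+1}.$$
   Context: Notation. $[m]=\{1,\dots,m\}$. $d=\sum_{i=1}^m d_i$, and $U_i\in\mathbb{R}^{d\times d_i}$ are such that $[U_1,\dots,U_m]=I_d$. For $x\in\mathbb{R}^d$, $x_i=U_i^Tx\in\mathbb{R}^{d_i}$ is the $i$-th block, so $x=\sum_i U_ix_i$; $\nabla_i f(x)=U_i^T\nabla f(x)$. $\|\cdot\|_i$ is the Euclidean norm on $\mathbb{R}^{d_i}$, $\|\cdot\|$ the Euclidean norm on $\mathbb{R}^d$. $L_{\max}=\max_iL_i$, $L_{\min}=\min_iL_i$. Standing assumptions. The problem is $\min_{x\in\mathbb{R}^d}F(x)=f(x)+\phi(x)-h(x)$, where: (i) $f:\mathbb{R}^d\to\mathbb{R}$ is continuously differentiable and block-wise Lipschitz smooth with constants $L_1,\dots,L_m>0$: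 $\|\nabla_i f(x)-\nabla_i f(x+U_it)\|_i\le L_i\|t\|_i$ for all $x\in\mathbb{R}^d$, $t\in\mathbb{R}^{d_i}$, $i\in[m]$; (ii) $\phi(x)=\sum_{i=1}^m\phi_i(x_i)$ with each $\phi_i:\mathbb{R}^{d_i}\to\mathbb{R}$ proper, convex, lower semicontinuous; (iii) $h:\mathbb{R}^d\to\mathbb{R}$ is convex and continuous; (iv) every lower level set $\{x:F(x)\le r\}$, $r\in\mathbb{R}$, is bounded; (v) there is $x^*$ with $F(x^* )=\min_xF(x)>-\infty$. A point $x$ is a critical point of $F$ if $[\nabla f(x)+\partial\phi(x)]\cap\partial h(x)\ne\emptyset$ (convex subdifferentials). For $\gamma_i>0$ and $\bar x_i,y_i\in\mathbb{R}^{d_i}$ define $\mathcal{P}_i(\bar x_i,y_i,\gamma_i)=\operatorname{argmin}_{x\in\mathbb{R}^{d_i}}\{\langle y_i,x\rangle+\phi_i(x)+\tfrac{\gamma_i}{2}\|\bar x_i-x\|_i^2\}$. RPCD algorithm. Input $x^0\in\mathbb{R}^d$. For $k=0,1,2,\dots$: choose $v^k\in\partial h(x^k)$ and set $\tilde x^0=x^k$; choose an arbitrary (deterministic or random) permutation $\pi_0,\pi_1,\dots,\pi_{m-1}$ of $[m]$; for $t=0,1,\dots,m-1$ set $\tilde x^{t+1}_{\pi_t}=\mathcal{P}_{\pi_t}\bigl(\tilde x^t_{\pi_t},\nabla_{\pi_t}f(\tilde x^t)-v^k_{\pi_t},\gamma_{\pi_t}\bigr)$ and $\tilde x^{t+1}_j=\tilde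 x^t_j$ for $j\neq\pi_t$; finally set $x^{k+1}=\tilde x^m$. *)

(* Defs.v *)
From mathcomp Require Import all_boot all_order all_algebra all_fingroup.
From mathcomp Require Import all_classical all_reals all_analysis.
Import Order.TTheory GRing.Theory Num.Theory.
Import numFieldNormedType.Exports.

Set Implicit Arguments.
Unset Strict Implicit.
Unset Printing Implicit Defensive.

Local Open Scope classical_set_scope.
Local Open Scope ring_scope.

(* R^n is the type 'cV[R]_n of column vectors.
   The library norm `|x| on 'cV[R]_n is the sup norm, so the Euclidean norm is
   defined here.  Purely topological notions (differentiability, continuity,
   semicontinuity, boundedness, cluster points) do not depend on the choice of
   norm and are the library ones. *)
Section Euclidean.
Context {R : realType} {n : nat}.
Implicit Types (x y g : 'cV[R]_n) (f : 'cV[R]_n -> R) (p : 'cV[R]_n -> \bar R).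

Definition inner x y : R := \sum_i x i 0 * y i 0.

Definition enorm x : R := Num.sqrt (inner x x).

Definition grad f x : 'cV[R]_n := \col_i 'D_(delta_mx i 0) f x.

Definition continuously_differentiable f : Prop :=
  (forall x, differentiable f x) /\ continuous (grad f).

Definition proper_efun p : Prop :=
  (forall x, p x != -oo%E) /\ (exists x, p x != +oo%E).

(* For p nowhere -oo the right-hand side is never +oo - oo; at t = 0 or 1 the
   convention 0 * +oo = 0 makes the inequality trivial. *)
Definition convex_efun p : Prop :=
  forall x y (t : R), 0 <= t <= 1 ->
    (p (t *: x + (1 - t) *: y)%R <= t%:E * p x + (1 - t)%:E * p y)%E.

Definition subdiff p x : set 'cV[R]_n :=
  [set g | forall y, (p x + (inner g (y - x)%R)%:E <= p y)%E].

Definition argmin p : set 'cV[R]_n := [set x | forall y, (p x <= p y)%E].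

Definition prox p (xbar y : 'cV[R]_n) (gamma : R) : set 'cV[R]_n :=
  argmin (fun x =>
    ((inner y x)%:E + p x + (gamma / 2 * enorm (xbar - x) ^+ 2)%R%:E)%E).

End Euclidean.

Section Blocks.
Context {R : realType} {m : nat} {d : 'I_m -> nat}.

(* [U_1, ..., U_m] = I, by submxrowK. *)
Definition blockU (i : 'I_m) : 'M[R]_(\sum_j d j, d i) := submxrow 1%:M i.

Definition block (x : 'cV[R]_(\sum_j d j)) (i : 'I_m) : 'cV[R]_(d i) :=
  (blockU i)^T *m x.

Definition blockwise_smooth (f : 'cV[R]_(\sum_j d j) -> R) (L : 'I_m -> R) :
    Prop :=
  forall x i (t : 'cV[R]_(d i)),
    enorm (block (grad f x) i - block (grad f (x + blockU i *m t)) i)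
      <= L i * enorm t.

(* The phi_i may take the value +oo; real-valued phi_i are a special case. *)
Definition separable (phi : forall i, 'cV[R]_(d i) -> \bar R)
    (x : 'cV[R]_(\sum_j d j)) : \bar R :=
  (\sum_i phi i (block x i))%E.

Definition objective f (phi : forall i, 'cV[R]_(d i) -> \bar R) h
    (x : 'cV[R]_(\sum_j d j)) : \bar R :=
  ((f x)%:E + separable phi x - (h x)%:E)%E.

Definition critical_point f (phi : forall i, 'cV[R]_(d i) -> \bar R) h
    (x : 'cV[R]_(\sum_j d j)) : Prop :=
  [set grad f x + g | g in subdiff (separable phi) x]
    `&` subdiff (EFin \o h) x !=set0.

Definition Lmax (L : 'I_m -> R) : R := \big[Num.max/0]_i L i.

(* The initial value Lmax L is neutral as soon as 0 < m. *)
Definition Lmin (L : 'I_m -> R) : R := \big[Num.min/Lmax L]_i L i.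

(* One outer iteration, from xk to xk1, with the subgradient vk of h at xk,
   some permutation s and inner iterates z 0, ..., z m. *)
Definition rpcd_step f (phi : forall i, 'cV[R]_(d i) -> \bar R) h
    (gamma : 'I_m -> R) (xk vk xk1 : 'cV[R]_(\sum_j d j)) : Prop :=
  subdiff (EFin \o h) xk vk /\
  exists (s : 'S_m) (z : nat -> 'cV[R]_(\sum_j d j)),
    [/\ z 0%N = xk,
        forall t : 'I_m,
          prox (phi (s t)) (block (z t) (s t))
            (block (grad f (z t)) (s t) - block vk (s t)) (gamma (s t))
            (block (z t.+1) (s t)) /\
          forall j, j != s t -> block (z t.+1) j = block (z t) j
      & xk1 = z m].

Definition rpcd f (phi : forall i, 'cV[R]_(d i) -> \bar R) h
    (gamma : 'I_m -> R) (x v : nat -> 'cV[R]_(\sum_j d j)) : Prop :=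
  forall k, rpcd_step f phi h gamma (x k) (v k) (x k.+1).

End Blocks.

(* Main.v *)
Require Import Defs.
From mathcomp Require Import all_boot all_order all_algebra all_fingroup.
From mathcomp Require Import all_classical all_reals all_analysis.
From mathcomp Require Import ring lra.
Import Order.TTheory GRing.Theory Num.Theory.
Import numFieldNormedType.Exports.

(** The argument compares consecutive outer iterates [x k] and [x k.+1].

    Write [s] for the step [x k.+1 - x k] and [w i] for the inner iterate at
    which block [i] is updated. Every block is updated exactly once per sweep,
    so [block s i] is the whole displacement of block [i], and the order of the
    updates only enters through the points [w i] ([rpcd_step_sweep]). Three
    inequalities are added up over the blocks:
    - block smoothness gives [f (w i + U_i s_i) - f (w i) <=
      <grad_i f (w i), s_i> + L_i/2 |s_i|^2] ([block_descent]), and the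
      left-hand sides add up to [f (x k.+1) - f (x k)];
    - the proximal step yields the subgradient [u_i = - (grad_i f (w i) - v_i) -
      gamma_i s_i] of [phi_i] at the new point ([prox_subdiff]), whence
      [phi_i] decreases by at least [- <u_i, s_i>];
    - [v k] is a subgradient of [h], so [h] increases by at least [<v, s>].
    All linear terms cancel and [F (x k.+1) + \sum_i (gamma_i - L_i/2) |s_i|^2
    <= F (x k)] remains ([sweep_decrease]).  When [phi] is extended valued,
    [F (x 0)] may be infinite, but every later iterate has a finite objective.

    If [L_i <= gamma_i], the values [F (x k.+1)] decrease and are bounded
    below, so the iterates after [x 0] stay in one level set and the steps tend
    to zero. At a cluster point [p], an ultrafilter [U] finer than [\oo] along
    which [x] tends to [p] replaces the extraction of subsequences: [x k.+1]
    and all [w i] then tend to [p] as well, and [v] tends to some [q] because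
    subgradients of the continuous function [h] are locally bounded
    ([subdiff_locally_bounded]). Since subdifferentials of lower semicontinuous
    functions have closed graph ([subdiff_closed]), the limit of [u_i] is [-
    (grad_i f p - q_i)] and belongs to the subdifferential of [phi_i], while
    [q] is a subgradient of [h] at [p]: thus [p] is critical.

    If [phi = 0] and [gamma = L], the subgradients [u_i] vanish, so
    [grad_i f (w i) - v_i = - L_i s_i].  As [w i] is no farther from [x k] than
    [x k.+1] is, replacing [w i] by [x k] costs at most [Lip |s|] in each block.
    Hence the squared residual is bounded by a multiple of the decrease of [F]
    ([sqr_residual_le]), and these decreases telescope over the iterations. *)

Set Implicit Arguments.
Unset Strict Implicit.
Unset Printing Implicit Defensive.

Local Open Scope classical_set_scope.
Local Open Scope ring_scope.

(** * Euclidean geometry of column vectors *)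

Lemma le_sum_term (R : numDomainType) (I : finType) (F : I -> R) i :
  (forall j, 0 <= F j) -> F i <= \sum_j F j.
Proof. by move=> F0; rewrite (bigD1 i)//= lerDl sumr_ge0. Qed.

Section EuclideanTheory.
Context {R : realType} {n : nat}.
Implicit Types (x y z : 'cV[R]_n).

Lemma innerE x y : inner x y = (x^T *m y) 0 0.
Proof. by rewrite mxE; apply: eq_bigr => i _; rewrite mxE. Qed.

Lemma innerC x y : inner x y = inner y x.
Proof. by apply: eq_bigr => i _; rewrite mulrC. Qed.

Lemma innerDr x y z : inner x (y + z) = inner x y + inner x z.
Proof. by rewrite !innerE mulmxDr mxE. Qed.

Lemma innerNr x y : inner x (- y) = - inner x y.
Proof. by rewrite !innerE mulmxN mxE. Qed.

Lemma innerZr a x y : inner x (a *: y) = a * inner x y.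
Proof. by rewrite !innerE -scalemxAr mxE. Qed.

Lemma innerDl x y z : inner (x + y) z = inner x z + inner y z.
Proof. by rewrite innerC innerDr !(innerC z). Qed.

Lemma innerNl x y : inner (- x) y = - inner x y.
Proof. by rewrite innerC innerNr innerC. Qed.

Lemma innerZl a x y : inner (a *: x) y = a * inner x y.
Proof. by rewrite innerC innerZr innerC. Qed.

Lemma inner_ge0 x : 0 <= inner x x.
Proof. by apply: sumr_ge0 => i _; rewrite -expr2 sqr_ge0. Qed.

Lemma inner_eq0 x : inner x x = 0 -> x = 0.
Proof.
move/eqP; rewrite psumr_eq0 => [/allP xx0|i _]; last by rewrite -expr2 sqr_ge0.
apply/colP => i; rewrite mxE; apply/eqP.
by rewrite -sqrf_eq0 expr2 (implyP (xx0 i _)) ?mem_index_enum.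
Qed.

Lemma inner0l x : inner 0 x = 0.
Proof. by rewrite -(scale0r 0) innerZl mul0r. Qed.

Lemma enorm_ge0 x : 0 <= enorm x.
Proof. exact: sqrtr_ge0. Qed.

Lemma sqr_enorm x : enorm x ^+ 2 = inner x x.
Proof. by rewrite sqr_sqrtr ?inner_ge0. Qed.

Lemma enormN x : enorm (- x) = enorm x.
Proof. by rewrite /enorm innerNl innerNr opprK. Qed.

Lemma enormZ a x : 0 <= a -> enorm (a *: x) = a * enorm x.
Proof.
move=> a0; rewrite /enorm innerZl innerZr mulrA -expr2 sqrtrM ?sqr_ge0//.
by rewrite sqrtr_sqr ger0_norm.
Qed.

Lemma normr_coord_enorm x i : `|x i 0| <= enorm x.
Proof.
rewrite -sqrtr_sqr ler_wsqrtr// expr2.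
apply: (le_sum_term (F := fun j => x j 0 * x j 0)) => j.
by rewrite -expr2 sqr_ge0.
Qed.

(** Cauchy-Schwarz, from the nonnegativity of [| |y| x - |x| y |^2]. *)
Lemma inner_le_enorm x y : inner x y <= enorm x * enorm y.
Proof.
have [x0|x0] := eqVneq (enorm x) 0.
  by rewrite x0 mul0r (@inner_eq0 x) ?inner0l// -sqr_enorm x0 expr0n.
have [y0|y0] := eqVneq (enorm y) 0.
  rewrite y0 mulr0 (@inner_eq0 y) ?(innerC x) ?inner0l//.
  by rewrite -sqr_enorm y0 expr0n.
have := inner_ge0 (enorm y *: x - enorm x *: y).
rewrite !(innerDl, innerDr, innerNl, innerNr, innerZl, innerZr) -!sqr_enorm.
rewrite (innerC y x); set a := enorm x; set b := enorm y; set c := inner x y.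
have ab : 0 < a * b by rewrite mulr_gt0// lt0r ?x0 ?y0 ?enorm_ge0.
move=> H; rewrite -(ler_pM2l ab); lra.
Qed.

(** The parallelogram identity, without the term [|x - y|^2]. *)
Lemma sqr_enormD_le x y :
  enorm (x + y) ^+ 2 <= 2 * (enorm x ^+ 2 + enorm y ^+ 2).
Proof.
have := inner_ge0 (x - y); rewrite !sqr_enorm.
by rewrite !(innerDl, innerDr, innerNl, innerNr) (innerC y x); lra.
Qed.

End EuclideanTheory.

(** * Block decomposition *)

Section BlockTheory.
Context {R : realType} {m : nat} {d : 'I_m -> nat}.
Implicit Types (x y : 'cV[R]_(\sum_j d j)).

Lemma blockE x i k : block x i k 0 = x (tagnat.Rank i k) 0.
Proof.
rewrite /block /blockU mxE (bigD1 (tagnat.Rank i k))//= !mxE eqxx mul1r.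
by rewrite [X in _ + X]big1 ?addr0// => j /negPf jn; rewrite !mxE jn mul0r.
Qed.

Lemma blockD x y i : block (x + y) i = block x i + block y i.
Proof. exact: mulmxDr. Qed.

Lemma blockN x i : block (- x) i = - block x i.
Proof. exact: mulmxN. Qed.

Lemma blockP x y : (forall i, block x i = block y i) -> x = y.
Proof.
move=> xy; apply/colP => r.
by rewrite -(tagnat.sig2K r) -!blockE xy.
Qed.

Lemma block_blockU i (t : 'cV[R]_(d i)) : block (blockU i *m t) i = t.
Proof.
apply/colP => k; rewrite blockE mxE (bigD1 k)//= [X in _ + X]big1 ?addr0.
  by rewrite !mxE eqxx mul1r.
move=> j jk; rewrite !mxE -val_eqE/= tagnat.eq_Rank eqxx/= val_eqE.
by rewrite eq_sym (negPf jk) mul0r.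
Qed.

Lemma block_blockU_neq i j (t : 'cV[R]_(d i)) :
  j != i -> block (blockU i *m t) j = 0.
Proof.
move=> ji; apply/colP => k; rewrite blockE [LHS]mxE [LHS]big1 ?mxE// => l _.
by rewrite !mxE -val_eqE/= tagnat.eq_Rank (negPf ji) mul0r.
Qed.

Lemma inner_blockU i (t : 'cV[R]_(d i)) x :
  inner x (blockU i *m t) = inner (block x i) t.
Proof. by rewrite !innerE /block trmx_mul trmxK mulmxA. Qed.

Lemma block_sum (u : forall i, 'cV[R]_(d i)) i :
  block (\sum_j blockU j *m u j) i = u i.
Proof.
rewrite /block mulmx_sumr (bigD1 i)//= [X in X + _]block_blockU.
rewrite [X in _ + X]big1 ?addr0//.
by move=> j ji; apply: block_blockU_neq; rewrite eq_sym.
Qed.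

Lemma sum_block x : \sum_i blockU i *m block x i = x.
Proof. by apply: blockP => i; rewrite block_sum. Qed.

Lemma inner_block x y : inner x y = \sum_i inner (block x i) (block y i).
Proof.
rewrite -{1}(sum_block y) innerE mulmx_sumr summxE.
by apply: eq_bigr => i _; rewrite -innerE inner_blockU.
Qed.

Lemma sqr_enorm_block x : enorm x ^+ 2 = \sum_i enorm (block x i) ^+ 2.
Proof.
by rewrite sqr_enorm inner_block; apply: eq_bigr => i _; rewrite sqr_enorm.
Qed.

End BlockTheory.

(** * Quadratic upper bound along a block *)

Section Descent.
Context {R : realType} {m : nat} {d : 'I_m -> nat}.

Lemma inner_deltar n (x : 'cV[R]_n) i : inner x (delta_mx i 0) = x i 0.
Proof.
rewrite /inner (bigD1 i)//= big1 ?addr0 => [|j /negPf ji].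
  by rewrite mxE !eqxx mulr1.
by rewrite mxE ji mulr0.
Qed.

Lemma derive_grad n (f : 'cV[R]_n -> R) x u :
  differentiable f x -> 'D_u f x = inner (grad f x) u.
Proof.
move=> fx; rewrite deriveE//.
have -> : u = \sum_i u i 0 *: delta_mx i 0.
  by rewrite [LHS]matrix_sum_delta; apply: eq_bigr => i _; rewrite big_ord1.
rewrite linear_sum/= innerE mulmx_sumr summxE; apply: eq_bigr => i _.
by rewrite linearZ/= -innerE innerZr inner_deltar mxE deriveE.
Qed.

(** Both difference quotients are the same function of the increment, so the
    directional derivative at [x + a *: u] is the derivative along the line. *)
Lemma is_derive_line n (f : 'cV[R]_n -> R) x u (a : R) :
  differentiable f (x + a *: u) ->
  is_derive a 1 (fun b : R => f (x + b *: u)) (inner (grad f (x + a *: u)) u).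
Proof.
move=> fx; have := derivableP (@diff_derivable _ _ _ f _ u fx).
rewrite derive_grad// => -[df Df].
have E : (fun h : R => h^-1 *: (f (h *: u + (x + a *: u)) - f (x + a *: u))) =
   (fun h : R => h^-1 *: (f (x + (h *: (1:R) + a) *: u) - f (x + a *: u))).
  by apply/funext => h; rewrite [h%:A]mulr1 scalerDl addrCA.
by split; [rewrite /derivable -E | rewrite /derive -E].
Qed.

(** Block smoothness bounds the slope of [f] along the segment in terms of the
    slope at its origin; subtracting the corresponding parabola leaves a
    function [G] with nonpositive derivative on [[0, 1]]. *)
Lemma block_descent (f : 'cV[R]_(\sum_j d j) -> R) (L : 'I_m -> R) x i
    (t : 'cV[R]_(d i)) :
  (forall y, differentiable f y) -> blockwise_smooth f L ->
  f (x + blockU i *m t) <=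
    f x + inner (block (grad f x) i) t + L i / 2 * enorm t ^+ 2.
Proof.
move=> f_diff f_smooth; set u := blockU i *m t.
set c := inner (block (grad f x) i) t; set q := enorm t ^+ 2.
pose G (a : R) : R := f (x + a *: u) - (a * c + L i / 2 * q * a ^+ 2).
have dG (a : R) : is_derive a 1 G
    (inner (grad f (x + a *: u)) u - (c + L i * q * a)).
  apply: is_deriveB; first exact: is_derive_line.
  apply: is_derive_eq.
  by rewrite /GRing.scale/=; field.
have : G 1 <= G 0.
  apply: (@ler0_derive1_le_cc _ G 0 1); rewrite ?in_itv/= ?lexx ?ler01//.
  - move=> a; rewrite in_itv/= => /andP[a0 a1].
    rewrite derive1E derive_val inner_blockU.
    have := inner_le_enorm
      (block (grad f (x + a *: u)) i - block (grad f x) i) t.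
    have := f_smooth x i (a *: t); rewrite -opprB enormN -/u -scalemxAr -/u.
    rewrite enormZ ?(ltW a0)// innerDl innerNl -/c => H1 H2.
    have : enorm (block (grad f (x + a *: u)) i - block (grad f x) i) * enorm t
      <= L i * (a * enorm t) * enorm t by rewrite ler_wpM2r ?enorm_ge0.
    rewrite /q; lra.
  - apply: continuous_subspaceT => a.
    exact/differentiable_continuous/derivable1_diffP.
rewrite /G scale1r scale0r addr0; lra.
Qed.

End Descent.

(** * Proximal points and subgradients *)

Section Proximal.
Context {R : realType} {n : nat}.
Implicit Types (p : 'cV[R]_n -> \bar R) (x y z g : 'cV[R]_n).

(** Avoids a limit: for [a < 0] the explicit point [t = -a / (|b| - a)]
    already violates the hypothesis. *)
Lemma ge0_of_affine_ge0 (a b : R) :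
  (forall t, 0 < t <= 1 -> 0 <= a + t * b) -> 0 <= a.
Proof.
move=> ab; rewrite leNgt; apply/negP => a0.
pose t := - a / (`|b| - a).
have ba : 0 < `|b| - a by rewrite subr_gt0 (lt_le_trans a0).
have t0 : 0 < t by rewrite divr_gt0// oppr_gt0.
have t1 : t <= 1 by rewrite ler_pdivrMr// mul1r lerDr.
have := ab t; rewrite t0 t1 => /(_ isT).
have : t * b <= t * `|b| by rewrite ler_pM2l// ler_norm.
have : t * (`|b| - a) = - a by rewrite mulfVK// gt_eqF.
have : t * a < 0 by rewrite nmulr_llt0.
lra.
Qed.

Lemma prox_fin_num p xbar y gamma x : proper_efun p ->
  prox p xbar y gamma x -> p x \is a fin_num.
Proof.
move=> [pNy [z pz]] /(_ z); rewrite fin_numE pNy/=.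
have := pNy z; case: (p z) pz => [pz _ _|//|//].
by case: (p x).
Qed.

(** First-order optimality for the proximal problem, obtained without a
    subdifferential calculus: comparing the minimizer [x] with the point
    [x + t (z - x)] and using convexity of [p] gives [0 <= a + t b] for
    [0 < t <= 1], where [a] is the gap in the subgradient inequality at [z]. *)
Lemma prox_subdiff p xbar y gamma x : proper_efun p -> convex_efun p ->
  prox p xbar y gamma x -> subdiff p x (- y - gamma *: (x - xbar)).
Proof.
move=> p_proper p_convex px z.
have /fineK := prox_fin_num p_proper px; move: (fine (p x)) => r /esym pxr.
rewrite pxr; have := p_proper.1 z; case pz: (p z) => [s||]// _; last first.
  by rewrite leey.
rewrite -EFinD lee_fin.
suff : 0 <= inner y (z - x) + s - r + gamma * inner (x - xbar) (z - x).
  by move=> H; rewrite innerDl !innerNl innerZl; lra.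
apply: (@ge0_of_affine_ge0 _ (gamma / 2 * enorm (z - x) ^+ 2)).
move=> t /andP[t0 t1].
have := px (t *: z + (1 - t) *: x).
have := p_convex z x t; rewrite (ltW t0) t1 => /(_ isT).
rewrite pxr pz -!EFinM -EFinD.
have := p_proper.1 (t *: z + (1 - t) *: x).
case: (p _) => [q _||//]; last by rewrite leNgt ltry.
rewrite -!EFinD !lee_fin => pq.
have -> : xbar - (t *: z + (1 - t) *: x) = - ((x - xbar) + t *: (z - x)).
  by rewrite scalerBl scale1r scalerBr; apply/colP => i; rewrite !mxE; ring.
have -> : xbar - x = - (x - xbar) by rewrite opprB.
have -> : t *: z + (1 - t) *: x = x + t *: (z - x).
  by apply/colP => i; rewrite !mxE; ring.
rewrite !enormN !sqr_enorm; move: (x - xbar) (z - x) => a b.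
rewrite !(innerDl, innerDr, innerZl, innerZr) (innerC b a) => H.
by rewrite -(pmulr_rge0 _ t0); lra.
Qed.

End Proximal.

Section Separable.
Context {R : realType} {m : nat} {d : 'I_m -> nat}.

Lemma subdiff_separable (phi : forall i, 'cV[R]_(d i) -> \bar R) x
    (u : forall i, 'cV[R]_(d i)) :
  (forall i, subdiff (phi i) (block x i) (u i)) ->
  subdiff (separable phi) x (\sum_i blockU i *m u i).
Proof.
move=> phiu y; rewrite inner_block -sumEFin -big_split/=.
apply: lee_sum => i _; rewrite block_sum blockD blockN; exact: phiu.
Qed.

End Separable.

(** * Limits of vectors and of subgradients *)

Section ColumnTopology.
Context {R : realType} {n : nat} {T : Type}.
Context {F : set_system T} {FF : Filter F}.
Implicit Types (X Y : T -> 'cV[R]_n) (x y : 'cV[R]_n).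

(** The topology of matrices is the product topology of their entries. *)
Lemma cvg_colP X x :
  (forall i, X k i 0 @[k --> F] --> x i 0) <-> X k @[k --> F] --> x.
Proof.
split=> [Xx A [P xP PA]|Xx i]; last first.
  exact: (cvg_comp _ _ Xx (@coord_continuous _ _ _ i 0 x)).
have /filter_forall : forall i, F (fun k => P i 0 (X k i 0)).
  by move=> i; exact/Xx/xP.
by apply: filterS => k Pk; apply: PA => i j; rewrite ord1.
Qed.

Lemma cvg_inner X Y x y : X k @[k --> F] --> x -> Y k @[k --> F] --> y ->
  inner (X k) (Y k) @[k --> F] --> inner x y.
Proof.
move=> /cvg_colP Xx /cvg_colP Yy.
apply: cvg_big => [|i _]; first exact: add_continuous.
exact: cvgM.
Qed.

Lemma cvg_enorm_le X Y y (e : T -> R) :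
  (forall k, enorm (X k - Y k) <= e k) -> e k @[k --> F] --> 0 ->
  Y k @[k --> F] --> y -> X k @[k --> F] --> y.
Proof.
move=> XYe e0 /cvg_colP Yy; apply/cvg_colP => i.
have D0 : (X k - Y k) i 0 @[k --> F] --> 0.
  apply/norm_cvg0P.
  apply: (@squeeze_cvgr _ _ _ _ (cst 0) e) => //; last exact: cvg_cst.
  apply: nearW => k.
  by rewrite normr_ge0/= (le_trans _ (XYe k))// normr_coord_enorm.
rewrite (_ : (fun k => _) = fun k => Y k i 0 + (X k - Y k) i 0).
  by rewrite -[y i 0]addr0; exact: cvgD.
by apply/funext => k; rewrite !mxE subrKC.
Qed.

End ColumnTopology.

Lemma cvg_block {R : realType} {m : nat} {d : 'I_m -> nat} {T : Type}
    {F : set_system T} {FF : Filter F} (X : T -> 'cV[R]_(\sum_j d j)) x i :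
  X k @[k --> F] --> x -> block (X k) i @[k --> F] --> block x i.
Proof.
move=> /cvg_colP Xx; apply/cvg_colP => k.
by rewrite blockE; under eq_cvg do rewrite blockE; exact: Xx.
Qed.

(** Closed graph of the subdifferential.  If the limit inequality failed at
    [y], there would be room for [p y <= a] and [a - <g, y - x> < b < p x];
    lower semicontinuity keeps [b < p (X k)] and continuity keeps
    [a - <G k, y - X k> < b], which contradicts the inequality at [X k]. *)
Lemma subdiff_closed {R : realType} {n : nat} {T : Type} {F : set_system T}
    {FF : ProperFilter F} (p : 'cV[R]_n -> \bar R)
    (X G : T -> 'cV[R]_n) (x g : 'cV[R]_n) :
  lower_semicontinuous p -> X k @[k --> F] --> x -> G k @[k --> F] --> g ->
  (\forall k \near F, subdiff p (X k) (G k)) -> subdiff p x g.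
Proof.
move=> p_lsc Xx Gg XG y; rewrite leNgt; apply/negP => pyx.
have cvg_c : inner (G k) (y - X k) @[k --> F] --> inner g (y - x).
  by apply: cvg_inner => //; apply: cvgB => //; exact: cvg_cst.
(* The cases only serve to pick real numbers between extended reals. *)
have [a [b [pya ba px]]] : exists a b : R,
    [/\ (p y <= a%:E)%E, a - inner g (y - x) < b & (b%:E < p x)%E].
  case: (p y) pyx => [r||]; last 2 first.
  - by case: (p x).
  - case: (p x) => [s||]//= _.
    + exists (s - 2 + inner g (y - x)), (s - 1); split; rewrite ?leNye//.
        by lra.
      by rewrite lte_fin; lra.
    + exists (inner g (y - x)), 1; split; rewrite ?leNye ?ltry//; lra.
  case: (p x) => [s||]// ; last first.
    move=> _; exists r, (r - inner g (y - x) + 1).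
    by split; rewrite ?ltry//; lra.
  rewrite -EFinD lte_fin => rs.
  exists r, ((r - inner g (y - x) + s) / 2).
  by split=> //; [lra | rewrite lte_fin; lra].
have [V Vx Vb] := p_lsc _ _ px.
suff : F set0 by apply: filter_not_empty.
have XV : \forall k \near F, V (X k) by exact: Xx.
have lt_c : \forall k \near F, a - b < inner (G k) (y - X k).
  by apply: (cvgr_gt _ cvg_c); lra.
apply: filterS3 XV lt_c XG => k /Vb bX abk /(_ y) /le_trans /(_ pya).
move: bX; case: (p (X k)) => [q||]//; rewrite -EFinD lte_fin lee_fin; lra.
Qed.

(** Plays the role of a convergent subsequence, with the advantage that further
    bounded quantities converge along the same [U]
    ([bounded_ultrafilter_cvg]), so that no second extraction is needed. *)
Lemma cluster_ultrafilter {T : Type} {V : topologicalType} {F : set_system T}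
    {FF : Filter F} (x : T -> V) p :
  cluster (x k @[k --> F]) p ->
  exists U : set_system T, [/\ UltraFilter U, F `<=` U & x k @[k --> U] --> p].
Proof.
move=> xp; pose G := [set A : set T |
  exists2 B, nbhs p B & F [set k | B (x k) -> A k]].
have GG : ProperFilter G.
  split.
    move=> [B pB FB].
    by have [v [vB Bv]] := xp (~` B) B FB pB.
  split.
  - exists setT; first exact: filterT.
    exact: filterS filterT.
  - move=> A A' [B pB FB] [B' pB' FB']; exists (B `&` B'); first exact: filterI.
    by apply: filterS2 FB FB' => k BA BA' [/BA ? /BA' ?].
  - move=> A A' AA' [B pB FB]; exists B => //.
    by apply: filterS FB => k BA /BA; exact: AA'.
have [U [UU GU]] := ultraFilterLemma GG.
exists U; split=> // A FA; apply: GU.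
  by exists setT; [exact: filterT | apply: filterS FA => k Ak _].
by exists A => //; apply: filterE => k.
Qed.

Lemma bounded_ultrafilter_cvg {R : realType} {T : Type} {U : set_system T}
    {UU : UltraFilter U} (u : T -> R) (M : R) :
  (\forall k \near U, `|u k| <= M) -> exists l : R, u k @[k --> U] --> l.
Proof.
move=> uM.
have uMM : (u k @[k --> U]) `[- M, M]%classic.
  by apply: filterS uM => k; rewrite /= in_itv/= ler_norml.
have [l [_ ul]] := @segment_compact R (- M) M _ _ uMM.
exists l => A lA; have [//|UnA] := in_ultra_setVsetC (u @^-1` A) UU.
by have [y [nAy Ay]] := ul (~` A) A UnA lA.
Qed.

(** A subgradient [v] at [y] satisfies [c v_i <= h (y + c e_i) - h y], and near
    [p] the right-hand side is less than 2 for all [c] with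
    [|c|] at most a quarter of the radius [r] on which [h] varies by less than
    1. *)
Lemma subdiff_locally_bounded {R : realType} {n : nat} (h : 'cV[R]_n -> R) p :
  {for p, continuous h} ->
  exists M : R, \forall y \near p, forall v, subdiff (EFin \o h) y v ->
    forall i, `|v i 0| <= M.
Proof.
move=> hp.
have /nbhs_ballP[/= r r0 rh] : \forall y \near p, `|h p - h y| < 1.
  by move/cvgrPdist_lt: hp; apply.
exists (8 / r).
have r2 : 0 < r / 2 by rewrite divr_gt0.
near=> y => v vy i.
have yp : ball p (r / 2) y by near: y; exact: nbhsx_ballx.
have step (c : R) : `|c| <= 1 -> c * v i 0 <= 8 / r.
  move=> c1; have := vy (y + (r / 4 * c) *: delta_mx i 0).
  rewrite /= [y + _]addrC addrK innerZr inner_deltar -EFinD lee_fin.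
  have : `|h p - h y| < 1 by apply: rh; apply: le_ball yp; lra.
  have : `|h p - h ((r / 4 * c) *: delta_mx i 0 + y)| < 1.
    apply: rh; rewrite [X in ball _ X](splitr r); apply: ball_triangle yp _.
    rewrite -ball_normE/= opprD addrCA subrr addr0 normrN normrZ.
    have d1 : `|delta_mx i 0 : 'cV[R]_n| <= 1.
      rewrite [leLHS]mx_normrE; apply/bigmax_leP; split=> // -[j k] _ /=.
      by rewrite mxE normr_nat lern1 leq_b1.
    rewrite normrM (gtr0_norm (_ : 0 < r / 4)) ?divr_gt0//.
    have : `|c| * `|delta_mx i 0 : 'cV[R]_n| <= 1 by rewrite mulr_ile1.
    rewrite -(ler_pM2l (_ : 0 < r / 4)) ?divr_gt0// => H.
    rewrite -mulrA (le_lt_trans H)//; lra.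
  rewrite !ltr_norml ler_pdivlMr// => /andP[h3 h4] /andP[h1 h2] H.
  lra.
rewrite ler_norml; apply/andP; split.
  by have := step (-1); rewrite normrN1 => /(_ (lexx _)); lra.
by have := step 1; rewrite normr1 mul1r => /(_ (lexx _)).
Unshelve. all: by end_near. Qed.

(** * One outer iteration *)

Section Sweep.
Context {R : realType} {m : nat} {d : 'I_m -> nat}.
Variables (f h : 'cV[R]_(\sum_j d j) -> R).
Variables (phi : forall i, 'cV[R]_(d i) -> \bar R) (gamma L : 'I_m -> R).
Arguments phi : clear implicits.
Implicit Types (x v y : 'cV[R]_(\sum_j d j)).

(** What the analysis retains of a sweep from [x] to [y]: [w i] is the inner
    iterate at which block [i] is updated.  The order of the updates has
    disappeared; its only traces are that each [w i] mixes blocks of [x] and [y]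
    and that the partial changes of [f] telescope. *)
Definition sweep_points x v y (w : 'I_m -> 'cV[R]_(\sum_j d j)) :=
  [/\ forall i, prox (phi i) (block x i) (block (grad f (w i)) i - block v i)
        (gamma i) (block y i),
      forall i j, block (w i) j = block x j \/ block (w i) j = block y j &
      f y - f x =
        \sum_i (f (w i + blockU i *m block (y - x) i) - f (w i))].

Lemma rpcd_step_sweep x v y :
  rpcd_step f phi h gamma x v y -> exists w, sweep_points x v y w.
Proof.
move=> [_ [s [z [z0 zP ->{y}]]]].
(* [s^-1 j] is the time at which block [j] is updated, its only change. *)
have zE t : (t <= m)%N -> forall j, block (z t) j =
    if ((s^-1)%g j < t)%N then block (z ((s^-1)%g j).+1) j else block x j.
  elim: t => [|t IH] tm j; first by rewrite z0.
  have [_ zt] := zP (Ordinal tm).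
  rewrite ltnS leq_eqVlt; have [jt|jt] := eqVneq ((s^-1)%g j) (Ordinal tm).
    by rewrite jt/= eqxx.
  have -> : (((s^-1)%g j : nat) == t) = false by apply/negbTE.
  rewrite /= zt ?IH ?(ltnW tm)//.
  by apply: contra jt => /eqP ->; rewrite permK.
have zmE j : block (z m) j = block (z ((s^-1)%g j).+1) j.
  by rewrite zE// ltn_ord.
have zsE i : block (z ((s^-1)%g i)) i = block x i.
  by rewrite zE ?ltnn// ltnW.
exists (fun i => z ((s^-1)%g i)); split.
- by move=> i; have [+ _] := zP ((s^-1)%g i); rewrite permKV zmE zsE.
- move=> i j; rewrite zE ?(ltnW (ltn_ord _))// -zmE.
  by case: ifP => _; [right|left].
- rewrite -[in LHS]z0 -(telescope_sumr (fun t => f (z t)))// big_mkord.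
  rewrite (reindex_inj (@perm_inj _ (s^-1)%g))/=.
  apply: eq_bigr => i _; congr (f _ - _); apply: blockP => j.
  rewrite blockD; have [->|ji] := eqVneq j i.
    by rewrite block_blockU blockD blockN zsE zmE subrKC.
  rewrite block_blockU_neq// addr0.
  by have [_ ->] := zP ((s^-1)%g i); rewrite ?permKV.
Qed.

Lemma sweep_points_dist x v y w i : sweep_points x v y w ->
  enorm (w i - x) <= enorm (y - x).
Proof.
move=> [_ wE _]; rewrite -ler_sqr ?nnegrE ?enorm_ge0// !sqr_enorm_block.
apply: ler_sum => j _; rewrite !blockD !blockN.
case: (wE i j) => -> //; rewrite subrr ler_sqr ?nnegrE ?enorm_ge0//.
by rewrite /enorm inner0l sqrtr0 sqrtr_ge0.
Qed.

(** The subgradient of [phi i] at the new block that [prox_subdiff] extracts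
    from the update of block [i]. *)
Definition prox_subgradient x v y (w : 'I_m -> 'cV[R]_(\sum_j d j)) i :=
  - (block (grad f (w i)) i - block v i) - gamma i *: block (y - x) i.

Hypothesis phi_proper : forall i, proper_efun (phi i).
Hypothesis phi_convex : forall i, convex_efun (phi i).

Lemma sweep_subdiff x v y w i : sweep_points x v y w ->
  subdiff (phi i) (block y i) (prox_subgradient x v y w i).
Proof.
move=> [pw _ _]; rewrite /prox_subgradient blockD blockN.
exact: prox_subdiff.
Qed.

Definition finite_blocks x := forall i, phi i (block x i) \is a fin_num.

Lemma sweep_finite x v y w : sweep_points x v y w -> finite_blocks y.
Proof. by move=> [pw _ _] i; exact: prox_fin_num (pw i). Qed.

(** [fine] sends infinite values to 0, so this is the objective only on
    [finite_blocks] ([objectiveE]). *)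
Definition robjective x : R := f x + \sum_i fine (phi i (block x i)) - h x.

Lemma objectiveE x : finite_blocks x ->
  objective f phi h x = (robjective x)%:E.
Proof.
move=> xfin; rewrite /objective /separable.
rewrite (eq_bigr (fun i => (fine (phi i (block x i)))%:E)).
  by rewrite sumEFin.
by move=> i _; rewrite fineK.
Qed.

(** An extended sum is finite only if all its terms are: infinite values of
    opposite signs do not cancel, as [+oo - oo = -oo]. *)
Lemma finite_blocksP x : objective f phi h x \is a fin_num <-> finite_blocks x.
Proof.
split=> [|/objectiveE ->//].
rewrite /objective !fin_numD => /andP[/andP[_ /sum_fin_numP xfin] _] i.
exact: xfin (mem_index_enum i) isT.
Qed.

(** Adds up the descent of [f], the subgradient inequality of each [phi i]
    at the new point tested at the old one, and the one of [h] at the old point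
    tested at the new one; the linear terms in [y - x] cancel. *)
Lemma sweep_decrease x v y w :
  (forall y, differentiable f y) -> blockwise_smooth f L ->
  subdiff (EFin \o h) x v -> finite_blocks x -> sweep_points x v y w ->
  robjective y + \sum_i (gamma i - L i / 2) * enorm (block (y - x) i) ^+ 2
    <= robjective x.
Proof.
move=> f_diff f_smooth hv xfin wP.
have xfin1 := sweep_finite wP.
have phi_le i : fine (phi i (block y i)) - fine (phi i (block x i)) <=
    inner (prox_subgradient x v y w i) (block (y - x) i).
  have := sweep_subdiff (i := i) wP (block x i).
  rewrite -(fineK (xfin i)) -(fineK (xfin1 i)) -EFinD lee_fin.
  have -> : block x i - block y i = - block (y - x) i.
    by rewrite blockD blockN opprB.
  by rewrite innerNr; lra.
have f_le i := block_descent (w i) (block (y - x) i) f_diff f_smooth.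
have h_ge : inner v (y - x) <= h y - h x.
  by have := hv y; rewrite -EFinD lee_fin; lra.
have [_ _ fE] := wP.
have : f y - f x +
    (\sum_i fine (phi i (block y i)) - \sum_i fine (phi i (block x i))) <=
    inner v (y - x) -
    \sum_i (gamma i - L i / 2) * enorm (block (y - x) i) ^+ 2.
  rewrite fE inner_block -!sumrB -big_split/=; apply: ler_sum => i _.
  move: (phi_le i) (f_le i); rewrite /prox_subgradient.
  rewrite !(innerDl, innerNl, innerZl) -sqr_enorm; lra.
rewrite /robjective; lra.
Qed.

End Sweep.

(** * The sequence of outer iterates *)

Section Convergence.
Context {R : realType} {m : nat} {d : 'I_m -> nat}.
Variables (f h : 'cV[R]_(\sum_j d j) -> R).
Variables (phi : forall i, 'cV[R]_(d i) -> \bar R).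
Arguments phi : clear implicits.
Variables (L gamma : 'I_m -> R) (xstar : 'cV[R]_(\sum_j d j)).
Variables (x v : nat -> 'cV[R]_(\sum_j d j)).
Hypothesis f_C1 : continuously_differentiable f.
Hypothesis L_gt0 : forall i, 0 < L i.
Hypothesis f_smooth : blockwise_smooth f L.
Hypothesis phi_proper : forall i, proper_efun (phi i).
Hypothesis phi_convex : forall i, convex_efun (phi i).
Hypothesis xstar_min : argmin (objective f phi h) xstar.
Hypothesis F_bounded : (-oo < objective f phi h xstar)%E.
Hypothesis x_rpcd : rpcd f phi h gamma x v.

Let Fr := robjective f h phi.

Lemma rpcd_finite k : finite_blocks phi (x k.+1).
Proof.
by have [w /sweep_finite] := rpcd_step_sweep (x_rpcd k); apply.
Qed.

(** The objective at [x 1] is finite, hence an upper bound for the minimum. *)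
Lemma xstar_finite : finite_blocks phi xstar.
Proof.
apply/(finite_blocksP f h); rewrite fin_real// F_bounded/=.
apply: le_lt_trans (xstar_min (x 1%N)) _.
by rewrite (objectiveE f h (rpcd_finite 0)) ltry.
Qed.

Lemma robjective_ge y : finite_blocks phi y -> Fr xstar <= Fr y.
Proof.
move=> yfin; have := xstar_min y.
by rewrite !objectiveE ?lee_fin//; exact: xstar_finite.
Qed.

Lemma rpcd_decrease k : finite_blocks phi (x k) ->
  Fr (x k.+1) + \sum_i (gamma i - L i / 2) * enorm (block (x k.+1 - x k) i) ^+ 2
    <= Fr (x k).
Proof.
move=> xfin; have [w wP] := rpcd_step_sweep (x_rpcd k).
exact: (sweep_decrease phi_proper phi_convex f_C1.1 f_smooth (x_rpcd k).1
  xfin wP).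
Qed.

Section ShortSteps.
Hypothesis gamma_ge : forall i, L i <= gamma i.

Lemma rpcd_coef_gt0 i : 0 < gamma i - L i / 2.
Proof. by have := L_gt0 i; have := gamma_ge i; lra. Qed.

(** Indices are shifted because [F (x 0)] may be [+oo]. *)
Lemma rpcd_nonincreasing : nonincreasing_seq (fun k => Fr (x k.+1)).
Proof.
apply/nonincreasing_seqP => k.
apply: le_trans (rpcd_decrease (rpcd_finite k)); rewrite lerDl.
apply: sumr_ge0 => i _; rewrite mulr_ge0 ?sqr_ge0//; exact/ltW/rpcd_coef_gt0.
Qed.

Lemma rpcd_bounded :
  (forall r : R, bounded_set [set y | (objective f phi h y <= r%:E)%E]) ->
  bounded_set (range x).
Proof.
move=> /(_ (Fr (x 1%N)))[M [Mreal HM]].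
exists (Num.max M `|x 0%N|); split; first exact: num_real.
move=> N; rewrite gt_max => /andP[MN xN] _ [[|k] _ <-]; first exact: ltW.
apply: HM MN _ _; rewrite /= objectiveE ?lee_fin; last exact: rpcd_finite.
exact: rpcd_nonincreasing.
Qed.

(** The squared step is at most [C] times the decrease of the objective, which
    tends to zero because a nonincreasing sequence bounded below converges. *)
Lemma rpcd_steps_cvg0 : enorm (x k - x k.+1) @[k --> \oo] --> (0 : R).
Proof.
pose D k := Fr (x k.+1) - Fr (x k.+2).
have D0 : D k @[k --> \oo] --> 0.
  have /cvg_ex[l Fl] : cvgn (fun k => Fr (x k.+1)).
    apply: nonincreasing_is_cvgn rpcd_nonincreasing _.
    by exists (Fr xstar) => _ [k _ <-]; exact/robjective_ge/rpcd_finite.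
  rewrite -(subrr l); apply: cvgB => //.
  by have := cvg_shiftS (fun k => Fr (x k.+1)) (nbhs l) => ->.
pose C := \sum_i (gamma i - L i / 2)^-1.
rewrite -(cvg_shiftS (fun k => enorm (x k - x k.+1))).
apply: (@squeeze_cvgr _ _ _ _ (cst 0) (fun k => Num.sqrt (C * D k)));
  last 2 first.
- exact: cvg_cst.
- rewrite -[X in _ --> X]sqrtr0 -(mulr0 C).
  apply: continuous_cvg; [exact: sqrt_continuous | exact: cvgMl_tmp].
apply: nearW => k; rewrite enorm_ge0/= -opprB enormN.
rewrite -(ger0_norm (enorm_ge0 _)) -sqrtr_sqr ler_wsqrtr//.
rewrite sqr_enorm_block mulr_suml; apply: ler_sum => i _.
rewrite -(ler_pM2l (rpcd_coef_gt0 i)) mulVKf ?gt_eqF ?rpcd_coef_gt0//.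
rewrite /D lerBrDl; apply: le_trans (rpcd_decrease (rpcd_finite k)).
rewrite lerD2l [leRHS](bigD1 i)//= lerDl sumr_ge0// => j _.
by rewrite mulr_ge0 ?sqr_ge0//; exact/ltW/rpcd_coef_gt0.
Qed.

(** All of [x k.+1], [w k i] and the subgradients converge along an ultrafilter
    [U] that follows [x] to the cluster point [p]; closedness of the
    subdifferentials then yields the two inclusions at [p]. *)
Lemma rpcd_cluster_critical :
  (forall i, lower_semicontinuous (phi i)) -> continuous h ->
  cluster (x k @[k --> \oo]) `<=` critical_point f phi h.
Proof.
move=> phi_lsc h_cont p /cluster_ultrafilter[U [UU ooU xp]].
have /choice[w wP] k := rpcd_step_sweep (x_rpcd k).
have [M vM] := subdiff_locally_bounded (h_cont p).
have /choice[q vq] : forall i, exists l : R, v k i 0 @[k --> U] --> l.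
  move=> i; apply: (bounded_ultrafilter_cvg (M := M)).
  have : \forall k \near U, forall g, subdiff (EFin \o h) (x k) g ->
      forall i, `|g i 0| <= M by exact: (xp _ vM).
  by apply: filterS => k /(_ _ (x_rpcd k).1).
have {}vq : v k @[k --> U] --> \col_i q i.
  by apply/cvg_colP => i; rewrite mxE.
have step0 : enorm (x k.+1 - x k) @[k --> U] --> 0.
  under eq_cvg do rewrite -opprB enormN.
  by move=> A /rpcd_steps_cvg0/ooU.
have x1p : x k.+1 @[k --> U] --> p by apply: (cvg_enorm_le _ step0 xp).
have wp i : w k i @[k --> U] --> p.
  by apply: (cvg_enorm_le _ step0 xp) => k; exact: sweep_points_dist (wP k).
have rp i : prox_subgradient f gamma (x k) (v k) (x k.+1) (w k) i @[k --> U] -->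
    - (block (grad f p) i - block (\col_i q i) i).
  rewrite -[X in _ --> X]subr0; apply: cvgB.
    apply: cvgN; apply: cvgB; last exact: cvg_block.
    by apply: cvg_block; apply: cvg_comp (wp i) _; exact: f_C1.2.
  rewrite -(scaler0 _ (gamma i)); apply: cvgZr.
  have <- : block (p - p) i = 0 by rewrite subrr /block mulmx0.
  by apply: cvg_block; apply: cvgB.
exists (\col_i q i); split; last first.
  apply: (subdiff_closed _ xp vq) => [y a /=|].
    rewrite lte_fin => ahy; exists [set z | a < h z] => [|z].
      exact: cvgr_gt (h_cont y) _ ahy.
    by rewrite lte_fin.
  by apply: nearW => k; exact: (x_rpcd k).1.
exists (\sum_i blockU i *m - (block (grad f p) i - block (\col_i q i) i)).
  apply: subdiff_separable => i.
  apply: (subdiff_closed (phi_lsc i) (cvg_block x1p) (rp i)).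
  by apply: nearW => k; exact: sweep_subdiff.
by apply: blockP => i; rewrite blockD block_sum opprB subrKC.
Qed.

End ShortSteps.

Section SmoothCase.
Variable Lip : R.
Hypothesis phi0 : forall y, separable phi y = 0%E.
Hypothesis gammaE : forall i, gamma i = L i.
Hypothesis grad_lip : forall y z,
  enorm (grad f y - grad f z) <= Lip * enorm (y - z).

Lemma separable0_finite y : finite_blocks phi y.
Proof.
by apply/(finite_blocksP f h); rewrite /objective phi0.
Qed.

(** Test the subgradient inequality in the direction [g] itself. *)
Lemma separable0_subdiff y g : subdiff (separable phi) y g -> g = 0.
Proof.
move=> /(_ (y + g)); rewrite !phi0 [y + g]addrC addrK add0e lee_fin => g0.
by apply: inner_eq0; apply/eqP; rewrite eq_le g0 inner_ge0.
Qed.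

Lemma Lmax_ge i : L i <= Lmax L.
Proof. exact: le_bigmax. Qed.

Lemma Lmin_le i : Lmin L <= L i.
Proof. exact: bigmin_le_cond. Qed.

Lemma Lmin_gt0 (i0 : 'I_m) : 0 < Lmin L.
Proof.
by apply/bigmin_gtP; split=> //; apply: lt_le_trans (L_gt0 i0) (Lmax_ge i0).
Qed.

(** With [s = x k.+1 - x k] and [E = \sum_i L_i |s_i|^2], the decrease of the
    objective is at least [E / 2].  In block [i] the residual at [x k] differs
    from the one at [w i], which is [- L_i s_i], by a gradient difference of
    norm at most [|Lip| |s|].  Squaring and summing gives at most
    [2 (m Lip^2 |s|^2 + Lmax E)], and [|s|^2 <= E / Lmin]. *)
Lemma sqr_residual_le (m_gt0 : (0 < m)%N) k :
  enorm (grad f (x k) - v k) ^+ 2 <=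
    4 * (Lmax L + m%:R * Lip ^+ 2 / Lmin L) * (Fr (x k) - Fr (x k.+1)).
Proof.
have Lmin0 := Lmin_gt0 (Ordinal m_gt0).
have [w wP] := rpcd_step_sweep (x_rpcd k).
set s := x k.+1 - x k.
pose E := \sum_i L i * enorm (block s i) ^+ 2.
have E_le : E <= 2 * (Fr (x k) - Fr (x k.+1)).
  have sumE : \sum_i (gamma i - L i / 2) * enorm (block s i) ^+ 2 = E / 2.
    by rewrite mulr_suml; apply: eq_bigr => i _; rewrite gammaE; field.
  by have := rpcd_decrease (separable0_finite (x k)); rewrite sumE; lra.
have s_le : Lmin L * enorm s ^+ 2 <= E.
  rewrite sqr_enorm_block mulr_sumr; apply: ler_sum => i _.
  by rewrite ler_wpM2r ?sqr_ge0 ?Lmin_le.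
have res0 i : block (grad f (w i)) i - block (v k) i = - (L i *: block s i).
  have : \sum_i blockU i *m
      prox_subgradient f gamma (x k) (v k) (x k.+1) w i = 0.
    apply: (@separable0_subdiff (x k.+1)); apply: subdiff_separable => j.
    exact: sweep_subdiff.
  move=> /(congr1 (fun y => block y i)).
  rewrite block_sum /prox_subgradient gammaE.
  rewrite [RHS]/block mulmx0 => /eqP; rewrite subr_eq0 => /eqP <-.
  by rewrite opprK.
have block_le i : enorm (block (grad f (x k) - v k) i) ^+ 2 <=
    2 * (Lip ^+ 2 * enorm s ^+ 2 + Lmax L * (L i * enorm (block s i) ^+ 2)).
  rewrite (_ : block _ i = block (grad f (x k) - grad f (w i)) i +
      (block (grad f (w i)) i - block (v k) i)); last first.
    by rewrite !blockD !blockN addrA subrK.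
  apply: le_trans (sqr_enormD_le _ _) _; rewrite ler_pM2l ?ltr0n// lerD//.
    rewrite -exprMn.
    apply: (@le_trans _ _ (enorm (grad f (x k) - grad f (w i)) ^+ 2)).
      rewrite [leRHS]sqr_enorm_block.
      apply: (le_sum_term (F := fun j => enorm (block _ j) ^+ 2)) => j.
      exact: sqr_ge0.
    apply: (@le_trans _ _ ((Lip * enorm (x k - w i)) ^+ 2)).
      rewrite lerXn2r ?nnegrE ?enorm_ge0//.
      exact: le_trans (enorm_ge0 _) (grad_lip _ _).
    rewrite !exprMn ler_wpM2l ?sqr_ge0// -opprB enormN.
    by rewrite lerXn2r ?nnegrE ?enorm_ge0//; exact: sweep_points_dist wP.
  rewrite res0 enormN enormZ; last exact: ltW.
  rewrite exprMn [X in X * _]expr2 -mulrA ler_wpM2r ?Lmax_ge//.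
  by rewrite mulr_ge0 ?sqr_ge0// ltW.
have sumE : \sum_(i < m) 2 * (Lip ^+ 2 * enorm s ^+ 2 +
      Lmax L * (L i * enorm (block s i) ^+ 2)) =
    2 * (m%:R * (Lip ^+ 2 * enorm s ^+ 2) + Lmax L * E).
  rewrite -mulr_sumr big_split/= sumr_const card_ord -mulr_sumr.
  by rewrite [X in 2 * (X + _)]mulr_natl.
have C0 : 0 <= m%:R * Lip ^+ 2 / Lmin L.
  by apply: divr_ge0; [rewrite mulr_ge0 ?sqr_ge0 ?ler0n | exact: ltW].
have Lmax0 : 0 <= Lmax L := le_trans (ltW (L_gt0 (Ordinal m_gt0))) (Lmax_ge _).
have H1 : m%:R * (Lip ^+ 2 * enorm s ^+ 2) <= m%:R * Lip ^+ 2 / Lmin L * E.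
  apply: le_trans (ler_wpM2l C0 s_le).
  by rewrite [leRHS]mulrA mulfVK ?mulrA// gt_eqF.
have := ler_wpM2l (addr_ge0 Lmax0 C0) E_le.
rewrite sqr_enorm_block => H2.
apply: le_trans (ler_sum _ (fun i _ => block_le i)) _.
rewrite sumE; lra.
Qed.

(** The minimum is at most the average, whose terms are bounded by
    differences of objective values that telescope. *)
Lemma min_sqr_residual_le (m_gt0 : (0 < m)%N) (K : nat) :
  \big[Num.min/enorm (grad f (x 0%N) - v 0%N) ^+ 2]_(k < K.+1)
     enorm (grad f (x k) - v k) ^+ 2 <=
  4 * (Lmax L + m%:R * Lip ^+ 2 / Lmin L) / K.+1%:R * (Fr (x 0%N) - Fr xstar).
Proof.
set mn := \big[_/_]_(_ < _) _.
set C := 4 * _.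
have mn_le (k : 'I_K.+1) : mn <= C * (Fr (x k) - Fr (x k.+1)).
  by apply: le_trans (sqr_residual_le m_gt0 k); apply: bigmin_le_cond.
have C0 : 0 <= C.
  apply: mulr_ge0 => //; apply: addr_ge0.
    exact: le_trans (ltW (L_gt0 (Ordinal m_gt0))) (Lmax_ge _).
  apply: divr_ge0; first by rewrite mulr_ge0 ?sqr_ge0 ?ler0n.
  exact/ltW/Lmin_gt0/(Ordinal m_gt0).
rewrite mulrAC ler_pdivlMr ?ltr0n//.
have : mn *+ K.+1 <= C * (Fr (x 0%N) - Fr (x K.+1)).
  rewrite -[X in _ <= C * X]opprB -(telescope_sumr (fun k => Fr (x k)))//.
  rewrite -sumrN mulr_sumr big_mkord -[X in _ *+ X]card_ord -sumr_const.
  by apply: ler_sum => k _; rewrite opprB.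
rewrite mulr_natr => /le_trans; apply; apply: ler_wpM2l => //.
by rewrite lerB//; exact/robjective_ge/separable0_finite.
Qed.

End SmoothCase.
End Convergence.

Theorem theorem5 (R : realType) (m : nat) (m_gt0 : (0 < m)%N)
    (d : 'I_m -> nat)
    (f h : 'cV[R]_(\sum_j d j) -> R)
    (phi : forall i, 'cV[R]_(d i) -> \bar R)
    (L gamma : 'I_m -> R)
    (xstar : 'cV[R]_(\sum_j d j))
    (x v : nat -> 'cV[R]_(\sum_j d j))
    (f_C1 : continuously_differentiable f)
    (L_gt0 : forall i, 0 < L i)
    (f_smooth : blockwise_smooth f L)
    (phi_proper : forall i, proper_efun (phi i))
    (phi_convex : forall i, convex_efun (phi i))
    (phi_lsc : forall i, lower_semicontinuous (phi i))
    (h_convex : convex_function setT h)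
    (h_continuous : continuous h)
    (F_levels : forall r : R,
       bounded_set [set y | (objective f phi h y <= r%:E)%E])
    (xstar_min : argmin (objective f phi h) xstar)
    (F_bounded : (-oo < objective f phi h xstar)%E)
    (gamma_gt0 : forall i, 0 < gamma i)
    (x_rpcd : rpcd f phi h gamma x v) :
  ((forall i, L i <= gamma i) ->
     [/\ bounded_set (range x),
         enorm (x k - x k.+1) @[k --> \oo] --> (0 : R)
       & cluster (x k @[k --> \oo]) `<=` critical_point f phi h]) /\
  (forall Lip : R,
     (forall y, separable phi y = 0%E) ->
     (forall i, gamma i = L i) ->
     (forall y z, enorm (grad f y - grad f z) <= Lip * enorm (y - z)) ->
     forall K : nat,
       ((\big[Num.min/enorm (grad f (x 0%N) - v 0%N) ^+ 2]_(k < K.+1)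
           enorm (grad f (x k) - v k) ^+ 2)%R%:E
        <= (4 * (Lmax L + m%:R * Lip ^+ 2 / Lmin L) / K.+1%:R)%R%:E
           * (objective f phi h (x 0%N) - objective f phi h xstar))%E).
Proof.
split=> [gamma_ge|Lip phi0 gammaE grad_lip K].
  split.
  - exact: (rpcd_bounded f_C1 L_gt0 f_smooth phi_proper phi_convex x_rpcd).
  - exact: (rpcd_steps_cvg0 f_C1 L_gt0 f_smooth phi_proper phi_convex
      xstar_min F_bounded x_rpcd).
  - exact: (rpcd_cluster_critical f_C1 L_gt0 f_smooth phi_proper phi_convex
      xstar_min F_bounded x_rpcd).
rewrite !objectiveE; [|exact: separable0_finite..].
rewrite -EFinB -EFinM lee_fin.
exact: (min_sqr_residual_le f_C1 L_gt0 f_smooth phi_proper phi_convex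
  xstar_min F_bounded x_rpcd).
Qed.
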